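(* Let $\sigma=\bigotimes_{k=1}^\infty\lambda_k$ be the product measure on $[0,1]^{\mathbb{N}}$ (coordinates indexed by $k=1,2,3,\dots$), where each $\lambda_k$ is Lebesgue measure on $[0,1]$. Then for $-1\le x\le 0$, \[ \varphi(x)=\sigma\Bigl\{(x_k)_{k\ge 1}\in[0,1]^{\mathbb{N}}\colon 0\le\sum_{k=1}^\infty\frac{x_k}{2^k}\le x+1\Bigr\}. \]
   Context: $\varphi\colon\mathbb{R}\to\mathbb{R}$ denotes the unique infinitely differentiable function with compact support such that $\operatorname{supp}(\varphi)=[-1,1]$, $\varphi(t)>0$ for all $t\in(-1,1)$, $\varphi(0)=1$, and $\varphi'(t)=2\bigl(\varphi(2t+1)-\varphi(2t-1)\bigr)$ for all $t\in\mathbb{R}$. *)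

(* Defs.v *)
From HB Require Import structures.
From mathcomp Require Import all_boot all_order all_algebra.
From mathcomp Require Import all_classical all_reals all_analysis.

Set Implicit Arguments.
Unset Strict Implicit.
Unset Printing Implicit Defensive.

Import Order.TTheory GRing.Theory Num.Theory.
Import numFieldNormedType.Exports.

Local Open Scope classical_set_scope.
Local Open Scope ring_scope.

Record is_rvachev_up (R : realType) (phi : R -> R) : Prop := IsRvachevUp {
  up_smooth : forall (n : nat) (t : R), derivable (phi^`(n))%classic t 1 ;
  up_supp : closure [set t | phi t != 0] = `[(-1), 1]%classic ;
  up_gt0 : forall t : R, -1 < t < 1 -> 0 < phi t ;
  up_at0 : phi 0 = 1 ;
  up_deriv : forall t,
    (phi^`())%classic t = 2 * (phi (2 * t + 1) - phi (2 * t - 1)) }.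

(* [0, 1] carries the trace of the Borel sigma-algebra of R. *)
Definition unit_interval (R : realType) : Type := {i01 R}.

Definition ui_val (R : realType) (x : unit_interval R) : R :=
  (x : {i01 R})%:num.

HB.instance Definition _ (R : realType) := Choice.on (unit_interval R).
HB.instance Definition _ (R : realType) :=
  isPointed.Build (unit_interval R) (0%:i01 : {i01 R}).
HB.instance Definition _ (R : realType) := Measurable.copy (unit_interval R)
  (g_sigma_algebra_preimageType
     (@ui_val R : unit_interval R -> measurableTypeR R)).

Lemma ui_val_inj (R : realType) : injective (@ui_val R).
Proof. by move=> x y; exact: val_inj. Qed.

Lemma ui_val_range (R : realType) : range (@ui_val R) = `[0, 1]%classic.
Proof.
apply/seteqP; split => [_ [x _ <-]|x].
  by rewrite /= in_itv /= /ui_val ge0 le1.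
rewrite /= in_itv /= => /andP[x0 x1].
by exists (Itv01 x0 x1 : unit_interval R).
Qed.

Definition lebesgue01 (R : realType) (A : set (unit_interval R)) : \bar R :=
  lebesgue_measure (@ui_val R @` A).

Section lebesgue01_measure.
Variable R : realType.

Let image_measurable (A : set (unit_interval R)) :
  measurable A -> measurable (@ui_val R @` A : set (measurableTypeR R)).
Proof.
move=> [B mB <-]; rewrite setTI.
have -> : @ui_val R @` (@ui_val R @^-1` B) = B `&` `[0, 1]%classic.
  apply/seteqP; split => [_ [x Bx <-]|x [Bx]].
    by split=> //; rewrite -ui_val_range; exists x.
  by rewrite -ui_val_range => -[y _ yx]; exists y; rewrite //= yx.
by apply: measurableI => //; exact: measurable_itv.
Qed.

Let lebesgue01_0 : lebesgue01 (set0 : set (unit_interval R)) = 0%E.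
Proof. by rewrite /lebesgue01 image_set0 measure0. Qed.

Let lebesgue01_ge0 (A : set (unit_interval R)) : (0 <= lebesgue01 A)%E.
Proof. exact: measure_ge0. Qed.

Let lebesgue01_sigma_additive : semi_sigma_additive (@lebesgue01 R).
Proof.
move=> F mF tF mUF; rewrite /lebesgue01 image_bigcup.
apply: (@measure_semi_sigma_additive _ _ _ (@lebesgue_measure R)).
- by move=> i; exact: image_measurable.
- apply/trivIsetP => i j _ _ ij; apply/seteqP; split => // _ [[x Fx <-] [y Fy]].
  move=> /ui_val_inj yx; rewrite yx in Fy.
  by have /trivIsetP/(_ i j I I ij) /seteqP[/(_ x) + _] := tF; apply.
- by rewrite -image_bigcup; exact: image_measurable.
Qed.

HB.instance Definition _ := isMeasure.Build _ _ _ (@lebesgue01 R)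
  lebesgue01_0 lebesgue01_ge0 lebesgue01_sigma_additive.

Let lebesgue01_setT : @lebesgue01 R setT = 1%E.
Proof.
rewrite /lebesgue01 ui_val_range lebesgue_measure_itv/= lte_fin ltr01.
by rewrite oppr0 adde0.
Qed.

HB.instance Definition _ := Measure_isProbability.Build _ _ _ (@lebesgue01 R)
  lebesgue01_setT.

End lebesgue01_measure.

(* The space T^N of sequences with the product sigma-algebra, generated by the
   coordinate maps. *)
Definition seq_space d (T : measurableType d) :=
  g_sigma_algebraType
    (\bigcup_k preimage_set_system setT (fun x : nat -> T => x k) measurable).

(* sigma is the product measure of the probability measures P k; by Dynkin's
   pi-lambda theorem at most one measure has this property, and the case n = 0
   gives sigma setT = 1. *)
Definition is_product_measure d (T : measurableType d) (R : realType)
    (P : nat -> probability T R)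
    (sigma : {measure set (seq_space T) -> \bar R}) : Prop :=
  forall (n : nat) (B : nat -> set T), (forall k, measurable (B k)) ->
    sigma [set x | forall k, (k < n)%N -> B k (x k)] =
    (\prod_(k < n) P k (B k))%E.

(* Main.v *)
Require Import Defs.
From HB Require Import structures.
From mathcomp Require Import all_boot all_order all_algebra.
From mathcomp Require Import all_classical all_reals all_analysis.
From mathcomp Require Import measurable_realfun ring lra.
Import Order.TTheory GRing.Theory Num.Theory.
Import numFieldNormedType.Exports.

Local Open Scope classical_set_scope.
Local Open Scope ring_scope.

(** Write [F] for the distribution function of the random sum
    [S = sum x_k / 2^k] and [G] for the function equal to [phi (y - 1)] up to
    [y = 1] and to [1] afterwards. The claim is [G = F] on [[0, 1]]; both
    functions satisfy the same self-similarity equation, which halves any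
    horizontal shift between them.

    For [F]: splitting off the first digit, [S = (s + S') / 2] where [s] is
    uniform and [S'] is an independent copy of [S], whence
    [F y = \int_0^1 F (2 y - s) ds] ([binary_cdf_integral]). The independence
    comes from the fact that the product measure is the image of the product of
    the one-digit law and itself under prefixing a digit
    ([product_measure_seq_cons]), which is checked on cylinders.

    For [G]: the integer translates of [phi] form a partition of unity
    ([up_partition]), because the derivative of their sum telescopes. This lets
    [G] be written as [phi (y - 1) + phi (y - 2)] for [y <= 2], and the
    functional equation of [phi] exhibits an antiderivative of that, so that
    [G y = \int_0^1 G (2 y - s) ds] for [y <= 1] ([integral_up_cdf]).

    Comparison: [F (y - 1) <= G y <= F (y + 1)] holds trivially since both go
    from [0] to [1] between [0] and [1]. If the inequalities hold with the shift
    [e] in place of [1], inserting them in the two integral equations yields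
    them with the shift [e / 2] ([binary_cdf_sandwich]). Letting the shift
    [2^-n] tend to [0], the continuity of [G] gives [F = G]. *)

(** * Measures of total mass one *)

Section probability_of_measure.
Context {d} {T : measurableType d} {R : realType}.
Context {mu : {measure set T -> \bar R}} (mu1 : mu setT = 1%E).

(** The proof that the mass is one is an argument, so that the structure of
    probability can be attached to the constant and inferred from it. *)
Definition prob_of_measure of mu setT = 1%E : set T -> \bar R := mu.

HB.instance Definition _ := Measure.on (prob_of_measure mu1).
HB.instance Definition _ :=
  Measure_isProbability.Build _ _ _ (prob_of_measure mu1) mu1.

End probability_of_measure.

(** * Sequence spaces and independence of the first coordinate *)

Section sequence_space.
Context {d} {T : measurableType d}.

Definition seq_cons (su : T * (nat -> T)) : nat -> T :=
  fun k => if k is k'.+1 then su.2 k' else su.1.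

Definition cylinder (n : nat) (B : nat -> set T) : set (nat -> T) :=
  [set u | forall k, (k < n)%N -> B k (u k)].

Definition cylinders : set (set (nat -> T)) :=
  [set A | exists n B, (forall k, measurable (B k)) /\ A = cylinder n B].

Lemma measurable_coord (k : nat) :
  measurable_fun [set: seq_space T] (fun u : seq_space T => u k).
Proof.
move=> _ Y mY; rewrite setTI; apply: sub_sigma_algebra.
by exists k => //; exists Y => //; rewrite setTI.
Qed.

Lemma measurable_fun_seq_space d' (X : measurableType d')
    (f : X -> seq_space T) :
  (forall k, measurable_fun [set: X] (fun x => f x k)) ->
  measurable_fun [set: X] f.
Proof.
move=> mf; refine (@measurability _ _ _ _ _ f _ (erefl _) _).
move=> _ [_ [k _ [Y mY <-]] <-].
by rewrite setTI; exact: mf.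
Qed.

Lemma measurable_seq_cons :
  measurable_fun [set: T * seq_space T] (seq_cons : T * seq_space T -> seq_space T).
Proof.
apply: measurable_fun_seq_space => -[|k] /=; first exact: measurable_fst.
apply: (measurableT_comp (measurable_coord k)); exact: measurable_snd.
Qed.

Lemma measurable_cylinder n (B : nat -> set T) :
  (forall k, measurable (B k)) ->
  measurable (cylinder n B : set (seq_space T)).
Proof.
move=> mB; rewrite (_ : cylinder n B =
  \bigcap_(k < n) [set u : seq_space T | B k (u k)]); last first.
  by apply/seteqP; split => u /= Bu k /Bu.
apply: bigcap_measurableType => k _.
by have := measurable_coord k measurableT _ (mB k); rewrite setTI.
Qed.

Lemma cylindersI : setI_closed cylinders.
Proof.
move=> _ _ [n [B [mB ->]]] [m [C [mC ->]]].
exists (maxn n m).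
exists (fun k => (if (k < n)%N then B k else setT) `&`
                 (if (k < m)%N then C k else setT)); split.
  by move=> k; apply: measurableI; case: ifP.
apply/seteqP; split => [u [Bu Cu] k _|u BCu].
  by split; case: ifP => // /[dup]; [move=> _; apply: Bu|move=> _; apply: Cu].
split => k kn; have := BCu k; rewrite leq_max kn ?orbT => /(_ isT)[];
  by [|case: ifP].
Qed.

(** Cylinders are stable under intersection and generate the sigma-algebra, so
    the uniqueness theorem for finite measures applies. *)
Lemma seq_space_measure_unique {R : realType}
    (m1 m2 : {measure set (seq_space T) -> \bar R}) :
  (m1 setT < +oo)%E ->
  (forall n B, (forall k, measurable (B k)) ->
     m1 (cylinder n B) = m2 (cylinder n B)) ->
  forall A, measurable A -> m1 A = m2 A.
Proof.
move=> m1oo m12; have cyl0 B : cylinder 0 B = setT.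
  by apply/seteqP; split => // u _ k.
refine (@measure_unique _ R (seq_space T) cylinders (fun=> setT)
  _ _ _ _ m1 m2 _ _) => //.
- apply/seteqP; split; apply: smallest_sub.
  + exact: smallest_sigma_algebra.
  + move=> _ [k _ [Y mY <-]]; apply: sub_sigma_algebra; exists k.+1.
    (* the condition on coordinate k is a cylinder with k trivial constraints *)
    exists (fun j => if j == k then Y else setT); split.
      by move=> j; case: ifP.
    rewrite setTI; apply/seteqP; split => u /= Yu => [j _|].
      by case: eqP => // ->.
    by have := Yu k (ltnSn k); rewrite eqxx.
  + exact: smallest_sigma_algebra.
  + by move=> _ [n [B [mB ->]]]; exact: measurable_cylinder.
- exact: cylindersI.
- by move=> _; exists 0%N, (fun=> setT); split => //; rewrite cyl0.
- by rewrite bigcup_const.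
- by move=> _ [n [B [mB ->]]]; exact: m12.
Qed.

(** In an i.i.d. sequence the first term is independent of the rest, and the
    rest has the law of the whole sequence. Both sides are measures of [A], and
    prefixing a coordinate pulls a cylinder back to a rectangle, on which the
    product formula gives the same value. *)
Lemma product_measure_seq_cons {R : realType} {P : probability T R}
    {sigma : probability (seq_space T) R} :
  is_product_measure (fun=> P) sigma ->
  forall A, measurable A ->
  sigma A = (\int[P]_s sigma [set u | A (seq_cons (s, u))])%E.
Proof.
move=> sigmaP A mA.
transitivity (pushforward (P \x sigma)%E
  (seq_cons : T * seq_space T -> seq_space T) A); last first.
  rewrite /pushforward /product_measure1; apply: eq_integral => s _ /=.
  by rewrite xsectionE.
apply: (@seq_space_measure_unique _ sigma (pushforward (P \x sigma)%E
  (seq_cons : T * seq_space T -> seq_space T))) => //.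
- exact: measurable_seq_cons.
- by rewrite [X in (X < _)%E](probability_setT sigma) ltry.
move=> mcons [|n] B mB.
  have -> : cylinder 0 B = setT by apply/seteqP; split => // u _ k.
  transitivity (1%E : \bar R); first exact: (probability_setT sigma).
  exact/esym/(probability_setT (P \x sigma)%E).
have consE : seq_cons @^-1` cylinder n.+1 B = B 0%N `*` cylinder n (B \o S).
  apply/seteqP; split=> [[s u] Bsu|[s u] [Bs Bu] [|k]] //=.
  - by split => [|k kn]; [exact: (Bsu 0%N)|exact: (Bsu k.+1)].
  - by rewrite ltnS => /Bu.
transitivity ((P \x sigma)%E (B 0%N `*` cylinder n (B \o S))); last first.
  by rewrite -consE.
rewrite product_measure1E//; last first.
  by apply: measurable_cylinder => k; exact: mB.
rewrite [LHS]sigmaP// big_ord_recl; congr (_ * _)%E.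
apply/esym/(sigmaP n (B \o S)) => k; exact: mB.
Qed.

End sequence_space.

(** * Random binary sums *)

Section binary_expansion.
Context {R : realType}.
Local Notation I := (unit_interval R).

Definition binary_sum (u : nat -> I) : R :=
  limn [series ui_val (u k) / 2 ^+ k.+1]_k.

Lemma ui_val_ge0 (s : I) : 0 <= ui_val s.
Proof. by rewrite /ui_val ge0. Qed.

Lemma ui_val_le1 (s : I) : ui_val s <= 1.
Proof. by rewrite /ui_val le1. Qed.

Let digit_ge0 (u : nat -> I) k : 0 <= ui_val (u k) / 2 ^+ k.+1.
Proof. by rewrite divr_ge0 ?ui_val_ge0// exprn_ge0. Qed.

Let digit_le (u : nat -> I) k :
  ui_val (u k) / 2 ^+ k.+1 <= geometric (2^-1) (2^-1) k.
Proof.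
by rewrite /geometric/= -exprS exprVn ler_piMl ?ui_val_le1// invr_ge0 exprn_ge0.
Qed.

Let half_lt1 : `|2^-1 : R| < 1.
Proof. by rewrite ger0_norm; lra. Qed.

Lemma is_cvg_binary_sum (u : nat -> I) :
  cvgn [series ui_val (u k) / 2 ^+ k.+1]_k.
Proof.
apply: (@series_le_cvg _ _ (geometric (2^-1) (2^-1))).
- exact: digit_ge0.
- by move=> k; rewrite (le_trans (digit_ge0 u k)) ?digit_le.
- exact: digit_le.
- apply: is_cvg_geometric_series; exact: half_lt1.
Qed.

Lemma binary_sum_ge0 (u : nat -> I) : 0 <= binary_sum u.
Proof.
apply: limr_ge; first exact: is_cvg_binary_sum.
by near=> n; rewrite /series/= sumr_ge0.
Unshelve. all: by end_near. Qed.

Lemma binary_sum_le1 (u : nat -> I) : binary_sum u <= 1.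
Proof.
have -> : 1 = limn (series (geometric (2^-1 : R) (2^-1))).
  have h := @cvg_geometric_series _ (2^-1) _ half_lt1.
  by rewrite (cvg_lim _ h)//; field.
apply: lim_series_le; [exact: is_cvg_binary_sum| |exact: digit_le].
apply: is_cvg_geometric_series; exact: half_lt1.
Qed.

Lemma binary_sum_cons (s : I) (u : nat -> I) :
  binary_sum (seq_cons (s, u)) = (ui_val s + binary_sum u) / 2.
Proof.
apply/cvg_lim => //; rewrite -cvg_shiftS.
rewrite [X in X @ _ --> _](_ : _ = fun n =>
    (ui_val s + [series ui_val (u k) / 2 ^+ k.+1]_k n) / 2); last first.
  apply/funext => n; rewrite /series/= big_nat_recl//= expr1 mulrDl.
  congr (_ + _); rewrite mulr_suml; apply: eq_bigr => k _.
  by rewrite [in LHS]exprSr invfM mulrA.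
apply: cvgM; last exact: cvg_cst.
apply: cvgD; first exact: cvg_cst.
exact: is_cvg_binary_sum.
Qed.

Lemma measurable_ui_val : measurable_fun [set: I] (@ui_val R).
Proof. by move=> _ Y mY; exists Y. Qed.

Lemma measurable_binary_sum :
  measurable_fun [set: seq_space I] (binary_sum : seq_space I -> R).
Proof.
refine (@measurable_fun_cvg _ (seq_space I) R setT
  (fun n u => [series ui_val (u k) / 2 ^+ k.+1]_k n) _ _ _).
- move=> n; apply: measurable_sum => k; apply: measurable_funM => //.
  exact: (measurableT_comp measurable_ui_val (measurable_coord k)).
- by move=> u _; exact: is_cvg_binary_sum.
Qed.

(** The uniform law on the unit interval is defined by images of sets in the
    line; pushing it back to the line gives Lebesgue measure restricted to
    [[0, 1]]. *)
Lemma integral_lebesgue01 (f : R -> \bar R) :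
  measurable_fun setT f -> (forall x, (0 <= f x)%E) ->
  (\int[@lebesgue01 R]_s f (ui_val s) =
   \int[lebesgue_measure]_(x in `[0%R, 1%R]) f x)%E.
Proof.
move=> mf f0.
transitivity (\int[pushforward (@lebesgue01 R)
  (@ui_val R : I -> measurableTypeR R)]_(x in `[0%R, 1%R]) f x)%E; last first.
  apply: eq_measure_integral; first exact: measurable_ui_val.
  move=> mval A mA A01; rewrite /= /pushforward /lebesgue01; congr lebesgue_measure.
  apply/seteqP; split => [_ [s As <-] //|x Ax].
  have : range (@ui_val R) x by rewrite ui_val_range; exact: A01.
  by move=> [s _ sx]; exists s => //=; rewrite sx.
rewrite ge0_integral_pushforward//.
- congr (integral _ _ _); apply/seteqP; split => // s _ /=.
  by rewrite in_itv/= ui_val_ge0 ui_val_le1.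
- exact: measurable_ui_val.
- exact: measurable_funTS.
Qed.

End binary_expansion.

(** * The function phi and its integral equation *)

Section up_function.
Context {R : realType} {phi : R -> R} (hphi : is_rvachev_up phi).

Lemma up_is_derive (t : R) :
  is_derive t 1 phi (2 * (phi (2 * t + 1) - phi (2 * t - 1))).
Proof.
rewrite -(up_deriv hphi) derive1E; apply: DeriveDef => //.
exact: (@up_smooth _ _ hphi 0%N t).
Qed.

Lemma up_continuous : continuous phi.
Proof.
move=> t; apply/differentiable_continuous/derivable1_diffP.
exact: (@up_smooth _ _ hphi 0%N t).
Qed.

Let up_neq0 (t : R) : phi t != 0 -> -1 <= t <= 1.
Proof.
move=> phit; have : [set` `[(-1 : R), 1]] t.
  by rewrite -(up_supp hphi); exact: subset_closure.
by rewrite /= in_itv.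
Qed.

Let up_neq0_near (t : R) : phi t != 0 -> \forall s \near t, -1 <= s <= 1.
Proof.
move=> phit; have : \forall s \near t, phi s != 0.
  exact: (cvgr_neq0 (phi t) (up_continuous t)).
by apply: filterS => s /up_neq0.
Qed.

(** The condition on the support says nothing about the value at [1] itself:
    continuity is needed there, as a nonzero value would persist beyond [1]. *)
Lemma up_eq0_ge1 (t : R) : 1 <= t -> phi t = 0.
Proof.
move=> t1; apply/eqP/negPn/negP => /up_neq0_near H.
have : \forall s \near t^'+, False.
  near=> s.
  have st : t < s by near: s; exact: nbhs_right_gt.
  have /andP[_] : -1 <= s <= 1 by near: s; exact: cvg_within H.
  lra.
by case/filter_ex.
Unshelve. all: by end_near. Qed.

Lemma up_eq0_leN1 (t : R) : t <= -1 -> phi t = 0.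
Proof.
move=> t1; apply/eqP/negPn/negP => /up_neq0_near H.
have : \forall s \near t^'-, False.
  near=> s.
  have st : s < t by near: s; exact: nbhs_left_lt.
  have /andP[+ _] : -1 <= s <= 1 by near: s; exact: cvg_within H.
  lra.
by case/filter_ex.
Unshelve. all: by end_near. Qed.

Lemma up_ge0 (t : R) : 0 <= phi t.
Proof.
have [t1|t1] := leP t (-1); first by rewrite up_eq0_leN1.
have [t2|t2] := leP 1 t; first by rewrite up_eq0_ge1.
by apply/ltW/(up_gt0 hphi)/andP.
Qed.

Lemma is_derive_up_affine (a b t : R) :
  is_derive t 1 (fun s => phi (a * s + b))
    (a * (2 * (phi (2 * (a * t + b) + 1) - phi (2 * (a * t + b) - 1)))).
Proof.
rewrite [X in is_derive _ _ _ X]mulrC.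
have dg : is_derive t 1 (fun s : R => a * s + b) a.
  have := is_deriveD (is_deriveZ a (is_derive_id t (1 : R))) (is_derive_cst b t (1 : R)).
  by move/is_derive_eq; apply; rewrite addr0 /GRing.scale/= mulr1.
exact: (@is_derive1_comp _ phi (fun s : R => a * s + b) t _ _ (up_is_derive _) dg).
Qed.

(** By the functional equation the derivative of the left-hand side is
    [2 * (phi (2 t + 1) - phi (2 t - 3))], the middle terms cancelling; both
    arguments lie outside the support, so the sum keeps its value at [0]. *)
Lemma up_partition (t : R) : 0 <= t <= 1 -> phi t + phi (t - 1) = 1.
Proof.
move=> /andP[t0 t1].
(* the second summand has the affine form of is_derive_up_affine *)
pose P s := phi s + phi (1 * s + (- 1)).
have dP (s : R) : is_derive s 1 P
    (2 * (phi (2 * s + 1) - phi (2 * s - 1)) +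
     1 * (2 * (phi (2 * (1 * s + (- 1)) + 1) - phi (2 * (1 * s + (-1)) - 1)))).
  exact: (is_deriveD (up_is_derive s) (is_derive_up_affine 1 (-1) s)).
have cP : {within `[0, t], continuous P}.
  apply: continuous_subspaceT => s.
  exact/differentiable_continuous/derivable1_diffP.
have [c] := MVT_segment t0 (fun s _ => dP s) cP.
rewrite in_itv/= => /andP[c0 ct].
rewrite (up_eq0_ge1 (2 * c + 1)); last lra.
rewrite (up_eq0_leN1 (2 * (1 * c + (- 1)) - 1)); last lra.
rewrite (_ : 2 * (1 * c + (- 1)) + 1 = 2 * c - 1); last ring.
rewrite /P (_ : 1 * t + -1 = t - 1); last ring.
rewrite (_ : 1 * 0 + -1 = -1); last ring.
rewrite (up_at0 hphi) (up_eq0_leN1 (-1)) // => h; lra.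
Qed.

Lemma up_le1 (t : R) : t <= 0 -> phi t <= 1.
Proof.
move=> t0; have [t1|t1] := leP t (-1); first by rewrite up_eq0_leN1.
have := @up_partition (t + 1); have := up_ge0 (t + 1).
rewrite addrK => ? /(_ _)/wrap[]; lra.
Qed.

(** This is [phi (y - 1)] continued by [1] to the right of [1]; truncating the
    argument makes its continuity immediate. *)
Definition up_cdf (y : R) : R := phi (Num.min y 1 - 1).

Lemma up_cdf_continuous : continuous up_cdf.
Proof.
move=> y; apply: (continuous_cvg _ (@up_continuous _)).
apply: cvgB; last exact: cvg_cst.
by apply: continuous_min; [exact: cvg_id|exact: cvg_cst].
Qed.

Lemma up_cdf_le y : y <= 1 -> up_cdf y = phi (y - 1).
Proof. by move=> y1; rewrite /up_cdf min_l. Qed.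

Lemma up_cdf_ge y : 1 <= y -> up_cdf y = 1.
Proof. by move=> y1; rewrite /up_cdf min_r// subrr (up_at0 hphi). Qed.

(** The two subtracted terms vanish when [w <= 2]; they are kept because the
    right-hand side is then exactly the derivative of
    [phi (w / 2 - 1) + phi ((w - 1) / 2 - 1)]. *)
Lemma up_cdf_translates w : w <= 2 ->
  up_cdf w = phi (w - 1) - phi (w - 3) + (phi (w - 2) - phi (w - 4)).
Proof.
move=> w2; rewrite (up_eq0_leN1 (w - 3)) ?(up_eq0_leN1 (w - 4)); try lra.
rewrite !subr0; have [w1|w1] := leP w 1.
  by rewrite up_cdf_le// (up_eq0_leN1 (w - 2)) ?addr0; lra.
rewrite up_cdf_ge ?(ltW w1)// -[LHS](@up_partition (w - 1)); last lra.
by congr (_ + phi _); ring.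
Qed.

(** The bound [y <= 1] keeps [2 * y - s] below [2], where the antiderivative
    read off from [up_cdf_translates] is valid. In the difference of its values
    at [2 * y] and [2 * y - 1] the terms [phi (y - 3 / 2)] cancel and
    [phi (y - 2)] is zero. *)
Lemma integral_up_cdf y : y <= 1 ->
  (\int[lebesgue_measure]_(s in `[0%R, 1%R]) (up_cdf (2 * y - s))%:E =
   (up_cdf y)%:E)%E.
Proof.
move=> y1.
(* minus the antiderivative above, evaluated at w = 2 * y - s *)
pose f (s : R) : R :=
  - phi ((- 2^-1) * s + (y - 1)) - phi ((- 2^-1) * s + (y - 3 / 2)).
have df' (s : R) := is_deriveB
  (is_deriveN (is_derive_up_affine (- 2^-1) (y - 1) s))
  (is_derive_up_affine (- 2^-1) (y - 3 / 2) s).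
have df (s : R) : 0 <= s -> is_derive s 1 f (up_cdf (2 * y - s)).
  move=> s0; have /is_derive_eq := df' s; apply.
  rewrite up_cdf_translates; last lra.
  have e (a b c d a' b' c' d' : R) : a = a' -> b = b' -> c = c' -> d = d' ->
    - (- 2^-1 * (2 * (phi a - phi b))) - - 2^-1 * (2 * (phi c - phi d)) =
    phi a' - phi b' + (phi c' - phi d') by move=> -> -> -> ->; field.
  by apply: e; field.
have cg : {within `[0, 1], continuous (fun s : R => up_cdf (2 * y - s))}.
  apply: continuous_subspaceT => s.
  apply: (continuous_cvg _ (@up_cdf_continuous _)).
  by apply: cvgB; [exact: cvg_cst|exact: cvg_id].
rewrite (@continuous_FTC2 _ (fun s : R => up_cdf (2 * y - s)) f 0 1 ltr01).
- rewrite -EFinB up_cdf_le// /f; congr (_%:E).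
  rewrite (_ : - 2^-1 * 1 + (y - 1) = y - 3 / 2); last by field.
  rewrite (up_eq0_leN1 (_ * 1 + _)); last lra.
  rewrite !mulr0 !add0r; ring.
- exact: cg.
- have cf (s : R) : {for s, continuous f}.
    apply/differentiable_continuous/derivable1_diffP.
    by have [] := df' s.
  split.
  + move=> s; rewrite in_itv/= => /andP[/ltW s0 _].
    by have [ds _] := df s s0; exact: ds.
  + apply: cvg_at_right_filter; exact: cf.
  + apply: cvg_at_left_filter; exact: cf.
- move=> s; rewrite in_itv/= => /andP[/ltW s0 _].
  by rewrite derive1E; have [_ ds] := df s s0; exact: ds.
Qed.

Lemma up_cdf_ge0 y : 0 <= up_cdf y. Proof. exact: up_ge0. Qed.

Lemma up_cdf_le1 y : up_cdf y <= 1.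
Proof. by apply: up_le1 => //; rewrite subr_le0 ge_min lexx orbT. Qed.

Lemma up_cdf_eq0 y : y <= 0 -> up_cdf y = 0.
Proof. by move=> y0; rewrite up_cdf_le ?up_eq0_leN1//; lra. Qed.

Lemma measurable_up_cdf y :
  measurable_fun setT (fun s : R => (up_cdf (2 * y - s))%:E).
Proof.
apply/measurable_EFinP; apply: continuous_measurable_fun => s.
apply: (continuous_cvg _ (@up_cdf_continuous _)).
by apply: cvgB; [exact: cvg_cst|exact: cvg_id].
Qed.

Lemma up_cdf_integral y : y <= 1 ->
  ((up_cdf y)%:E = \int[@lebesgue01 R]_s (up_cdf (2 * y - ui_val s))%:E)%E.
Proof.
move=> y1; rewrite (integral_lebesgue01 (fun s => (up_cdf (2 * y - s))%:E)).
- by rewrite integral_up_cdf.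
- exact: measurable_up_cdf.
- by move=> s; rewrite lee_fin up_cdf_ge0.
Qed.

End up_function.

(** * The distribution function of the binary sum *)

Section distribution_function.
Context {R : realType}.
Local Notation I := (unit_interval R).
Context {sigma : probability (seq_space I) R}
  (sigmaP : is_product_measure (fun=> @lebesgue01 R) sigma).

Definition binary_cdf (y : R) : \bar R := sigma [set u | binary_sum u <= y].

Lemma binary_cdf_eq0 y : y < 0 -> binary_cdf y = 0%E.
Proof.
move=> y0; rewrite /binary_cdf (_ : [set _ | _] = set0) ?measure0//.
apply/seteqP; split => // u /= uy.
by have := lt_le_trans y0 (binary_sum_ge0 u); rewrite ltNge uy.
Qed.

Lemma binary_cdf_eq1 y : 1 <= y -> binary_cdf y = 1%E.
Proof.
move=> y1; rewrite /binary_cdf (_ : [set _ | _] = setT).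
  exact: (probability_setT sigma).
by apply/seteqP; split => // u _ /=; rewrite (le_trans _ y1)// binary_sum_le1.
Qed.

Lemma binary_cdf_le1 y : (binary_cdf y <= 1)%E.
Proof.
apply: (probability_le1 sigma); rewrite -[X in measurable X]setTI.
exact: (measurable_fun_le _ measurable_binary_sum).
Qed.

(** Conditioning on the first digit [s]: the sum is at most [y] exactly when
    the sum of the shifted sequence is at most [2 * y - s]. *)
Lemma binary_cdf_integral y :
  binary_cdf y = (\int[@lebesgue01 R]_s binary_cdf (2 * y - ui_val s))%E.
Proof.
rewrite /binary_cdf (product_measure_seq_cons sigmaP); last first.
  rewrite -[X in measurable X]setTI.
  exact: (measurable_fun_le _ measurable_binary_sum).
apply: eq_integral => s _; congr (sigma _); apply/funext => u.
by apply/propext; rewrite /= binary_sum_cons; split; lra.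
Qed.

(** As a function of [s] this is the measure of the sections of a measurable
    set of pairs. *)
Lemma measurable_binary_cdf y :
  measurable_fun setT (fun s : I => binary_cdf (2 * y - ui_val s)).
Proof.
pose A := [set su : I * seq_space I | ui_val su.1 + binary_sum su.2 <= 2 * y].
rewrite (_ : (fun s => _) = sigma \o xsection A); last first.
  apply/funext => s /=; rewrite /binary_cdf xsectionE; congr (sigma _).
  by apply/funext => u; apply/propext; rewrite /A /=; split; lra.
apply: measurable_fun_xsection; rewrite -[X in measurable X]setTI.
apply: measurable_fun_le => //; apply: measurable_funD.
  exact: (measurableT_comp measurable_ui_val measurable_fst).
exact: (measurableT_comp measurable_binary_sum measurable_snd).
Qed.

Context {phi : R -> R} (hphi : is_rvachev_up phi).
Local Notation G := (@up_cdf R phi).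

(** The map [y |-> 2 * y - s] doubles a shift of the argument, so one use of the
    two integral equations halves the shift in the induction hypothesis. For
    [1 <= y], beyond the reach of [up_cdf_integral], the middle term is [1] and
    so is the upper bound. *)
Lemma binary_cdf_sandwich n y :
  (binary_cdf (y - 2^-1 ^+ n) <= (G y)%:E <= binary_cdf (y + 2^-1 ^+ n))%E.
Proof.
elim: n y => [|n IHn] y.
  rewrite expr0; apply/andP; split.
    have [y1|y1] := leP 1 y; first by rewrite up_cdf_ge// binary_cdf_le1.
    by rewrite binary_cdf_eq0 ?lee_fin ?up_cdf_ge0//; lra.
  have [y0|y0] := leP y 0; first by rewrite up_cdf_eq0// measure_ge0.
  by rewrite binary_cdf_eq1 ?lee_fin ?up_cdf_le1//; lra.
have [y1|y1] := leP 1 y.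
  rewrite up_cdf_ge// binary_cdf_le1/= binary_cdf_eq1//.
  by rewrite (le_trans y1)// lerDl exprn_ge0.
rewrite up_cdf_integral ?(ltW y1)// !binary_cdf_integral.
have mG : measurable_fun setT (fun s : I => (G (2 * y - ui_val s))%:E).
  exact: (measurableT_comp (measurable_up_cdf hphi y) measurable_ui_val).
apply/andP; split; apply: ge0_le_integral => //.
- exact: measurable_binary_cdf.
- move=> s _; have /andP[+ _] := IHn (2 * y - ui_val s).
  by rewrite (_ : 2 * (y - _) - _ = 2 * y - ui_val s - 2^-1 ^+ n)// exprS; field.
- by move=> s _; rewrite lee_fin up_cdf_ge0.
- exact: measurable_binary_cdf.
- move=> s _; have /andP[_] := IHn (2 * y - ui_val s).
  by rewrite (_ : 2 * (y + _) - _ = 2 * y - ui_val s + 2^-1 ^+ n)// exprS; field.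
Qed.

(** Apply the sandwich at [y + 2^-n] and at [y - 2^-n] to place the value of the
    distribution function at the fixed point [y] between two values of the
    continuous function [up_cdf] that converge to each other. *)
Lemma binary_cdfE y : binary_cdf y = (G y)%:E.
Proof.
have half_cvg : (fun n => 2^-1 ^+ n : R) @ \oo --> 0.
  by apply: cvg_expr; rewrite ger0_norm; lra.
have cvg_up (e : R^nat) : e @ \oo --> 0 -> (fun n => G (y + e n)) @ \oo --> G y.
  move=> e0; apply: (continuous_cvg _ (up_cdf_continuous hphi _)).
  by rewrite -[X in _ --> X]addr0; apply: cvgD => //; exact: cvg_cst.
have cp := cvg_up _ half_cvg.
have /cvg_up cm : (fun n => - (2^-1 ^+ n) : R) @ \oo --> 0.
  by rewrite -oppr0; exact: cvgN.
have ub n : (binary_cdf y <= (G (y + 2^-1 ^+ n))%:E)%E.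
  by have := binary_cdf_sandwich n (y + 2^-1 ^+ n); rewrite addrK => /andP[].
have lb n : ((G (y - 2^-1 ^+ n))%:E <= binary_cdf y)%E.
  by have := binary_cdf_sandwich n (y - 2^-1 ^+ n); rewrite subrK => /andP[].
have [r yr] : exists r, binary_cdf y = r%:E.
  by move: (ub 0%N) (lb 0%N); case: (binary_cdf y) => // r _ _; exists r.
rewrite yr; congr _%:E; apply/eqP; rewrite eq_le; apply/andP; split.
  rewrite -(cvg_lim _ cp)//; apply: limr_ge; first exact: cvgP cp.
  by apply: nearW => n; rewrite -lee_fin -yr.
rewrite -(cvg_lim _ cm)//; apply: limr_le; first exact: cvgP cm.
by apply: nearW => n; rewrite -lee_fin -yr.
Qed.

End distribution_function.

(* u k is the coordinate x_(k+1). *)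
Theorem theorem3 (R : realType) (phi : R -> R)
    (sigma : {measure set (seq_space (unit_interval R)) -> \bar R})
    (hphi : is_rvachev_up phi)
    (hsigma : is_product_measure (fun _ : nat => @lebesgue01 R) sigma)
    (x : R) (hx : -1 <= x <= 0) :
  (phi x)%:E =
  sigma [set u : nat -> unit_interval R |
          0 <= limn [series ui_val (u k) / 2 ^+ k.+1]_k <= x + 1].
Proof.
have sigmaT : sigma setT = 1%E.
  (* the product formula with no constraint at all *)
  have := hsigma 0%N (fun=> setT) (fun=> measurableT); rewrite big_ord0 => <-.
  by congr (sigma _); apply/seteqP; split.
have := @binary_cdfE R (prob_of_measure sigmaT) hsigma phi hphi (x + 1).
rewrite up_cdf_le; last by case/andP: hx => *; lra.
rewrite addrK => <-; congr (sigma _); apply/funext => u; apply/propext => /=.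
by rewrite binary_sum_ge0.
Qed.
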